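(* Let $t\ge 1$ and $n\ge 2t$ be integers. A nonempty subset $D\subseteq S_n$ is a $t$-design in $(S_n,d_S)$ if and only if, for every $k\in\{1,\dots,t\}$, $$\sum_{i=1}^n f_i\bigl(\widehat{C_k}(0)-\widehat{C_k}(i)\bigr)=\widehat{C_k}(0),$$ where $\widehat{C_k}(x)=C_k(n-x)$.
   Context: $S_n$ is the symmetric group on $n$ letters. For $\nu\in S_n$ let $F(\nu)$ be its number of fixed points; the metric is $d_S(\sigma,\theta)=n-F(\sigma\theta^{-1})$. For $j\in\{0,\dots,n\}$ let $v_j$ be the number of permutations with exactly $n-j$ fixed points. For nonempty $D\subseteq S_n$, its frequencies are $f_i=|\{(x,y)\in D^2: d_S(x,y)=i\}|/|D|^2$, $i=0,\dots,n$. $D$ is a $t$-design if $\sum_{j=0}^n f_j j^i=\sum_{j=0}^n \frac{v_j}{n!} j^i$ for every $i=1,\dots,t$. For $k\ge 0$, the Charlier polynomial is $C_k(x)=(-1)^k+\sum_{i=1}^k(-1)^{k-i}\binom{k}{i}x(x-1)\cdots(x-i+1)$. *)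

(* Defs.v *)
From mathcomp Require Import all_boot all_order all_fingroup all_algebra.

Set Implicit Arguments.
Unset Strict Implicit.
Unset Printing Implicit Defensive.

Import GRing.Theory.
Local Open Scope ring_scope.

Definition fixed_points n (s : 'S_n) : nat := #|[set x : 'I_n | s x == x]|.

(* The subtraction is on nat and never truncates, as at most n points are fixed.
   The product of permutations composes left to right; the other order gives
   a conjugate of s * u^-1, hence the same number of fixed points. *)
Definition dist_perm n (s u : 'S_n) : nat :=
  (n - fixed_points (s * u^-1)%g)%N.

(* Meaningful only for j <= n: beyond that n - j truncates to 0. *)
Definition perm_count (n j : nat) : nat :=
  #|[set s : 'S_n | fixed_points s == (n - j)%N]|.

Definition frequency n (D : {set 'S_n}) (i : nat) : rat :=
  #|[set p : 'S_n * 'S_n |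
      [&& p.1 \in D, p.2 \in D & dist_perm p.1 p.2 == i]]|%:R
  / (#|D| ^ 2)%:R.

Definition is_design n (t : nat) (D : {set 'S_n}) : Prop :=
  forall i : nat, (1 <= i <= t)%N ->
    \sum_(0 <= j < n.+1) frequency D j * j%:R ^+ i
    = \sum_(0 <= j < n.+1) (perm_count n j)%:R / n`!%:R * j%:R ^+ i.

Definition charlier (k : nat) : {poly rat} :=
  (-1) ^+ k
  + \sum_(1 <= i < k.+1)
      ((-1) ^+ (k - i) * 'C(k, i)%:R) *: \prod_(0 <= j < i) ('X - j%:R%:P).

Definition charlier_hat (n k : nat) (x : rat) : rat := (charlier k).[n%:R - x].

(* Main.v *)
Require Import Defs.
From mathcomp Require Import all_boot all_order all_fingroup all_algebra.

Set Implicit Arguments.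
Unset Strict Implicit.
Unset Printing Implicit Defensive.

Import GRing.Theory Num.Theory.
Local Open Scope ring_scope.

(** Subtracting the distance distribution of the whole group from that of [D]
    gives a linear functional on polynomials that vanishes on constants.  Being a
    [t]-design means that it vanishes in degree at most [t].  The reflected
    Charlier polynomials have one member in each degree, so it is enough to
    test them, and they have mean zero over the group because every factorial
    moment of order at most [n] of the number of fixed points equals 1. *)

(** Serves both distributions: distances of pairs in [D], and numbers of moved points over the whole
    group. *)
Lemma sum_card_fiber (T : finType) (R : pzRingType) (P : pred T)
    (h : T -> nat) (g : nat -> R) (N : nat) :
    (forall x, h x < N)%N ->
  \sum_(0 <= j < N) #|[set x | P x && (h x == j)]|%:R * g j
  = \sum_(x | P x) g (h x).
Proof.
move=> hN; rewrite big_mkord.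
rewrite (partition_big (fun x => Ordinal (hN x)) xpredT) //=.
apply: eq_bigr => j _; rewrite mulr_natl -sumr_const.
by apply: eq_big => [x|x]; rewrite inE // => /andP[_ /eqP ->].
Qed.

(** By induction on [t]: subtracting the multiple of [q t] that cancels the coefficient of degree
    [t] leaves a polynomial of smaller size. *)
Lemma functional_eq0 (R : fieldType) (d : nat -> R) (q : nat -> {poly R})
    (N t : nat) :
    (forall k, size (q k) = k.+1) ->
    (forall k, (k < t)%N -> \sum_(0 <= j < N) d j * (q k).[j%:R] = 0) ->
  forall p : {poly R}, (size p <= t)%N ->
  \sum_(0 <= j < N) d j * p.[j%:R] = 0.
Proof.
move=> sz_q; elim: t => [|t IHt] q0 p sz_p.
  move: sz_p; rewrite leqn0 size_poly_eq0 => /eqP ->.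
  by rewrite big1 // => j _; rewrite horner0 mulr0.
have qt : (q t)`_t != 0.
  by have := lead_coef_eq0 (q t); rewrite lead_coefE -size_poly_eq0 sz_q => ->.
set c := p`_t / (q t)`_t; pose r := p - c *: q t.
have sz_r : (size r <= t)%N.
  apply/leq_sizeP => i; rewrite leq_eqVlt => /predU1P[<-|lt_ti].
    by rewrite coefB coefZ mulfVK ?subrr.
  rewrite coefB coefZ !nth_default ?mulr0 ?subr0 ?sz_q //.
  exact: leq_trans lt_ti.
have q0W k : (k < t)%N -> \sum_(0 <= j < N) d j * (q k).[j%:R] = 0.
  by move=> lt_kt; apply: q0; apply: leqW.
rewrite (eq_bigr (fun j => d j * r.[j%:R] + c * (d j * (q t).[j%:R]))) => [|j _].
  by rewrite big_split /= -mulr_sumr q0 // (IHt q0W _ sz_r) mulr0 addr0.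
by rewrite /r hornerD hornerN hornerZ mulrBr [c * _]mulrCA subrK.
Qed.

Lemma horner_falling (R : comNzRingType) (i m : nat) :
  (\prod_(0 <= j < i) ('X - j%:R%:P)).[m%:R] = (m ^_ i)%:R :> R.
Proof.
elim: i => [|i IHi]; first by rewrite big_geq // hornerC ffactn0.
rewrite big_nat_recr //= hornerM IHi ffactnSr natrM !hornerE.
(* If [m < i], the natural subtraction truncates, but then [m ^_ i] is 0 and both sides vanish. *)
by case: (leqP i m) => [/natrB -> //|/ffact_small ->]; rewrite !mul0r.
Qed.

Lemma size_falling (R : idomainType) (i : nat) :
  size (\prod_(0 <= j < i) ('X - j%:R%:P) : {poly R}) = i.+1.
Proof. by rewrite size_prod_XsubC size_iota subn0. Qed.

Lemma charlierE (k : nat) :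
  charlier k = \sum_(0 <= i < k.+1)
    ((-1) ^+ (k - i) * 'C(k, i)%:R) *: \prod_(0 <= j < i) ('X - j%:R%:P).
Proof.
rewrite big_nat_recl // big_geq // subn0 bin0 mulr1 /charlier big_add1 /=.
(* One sign is a polynomial, the other a scalar acting on 1; the parity of [k] decides both. *)
by congr (_ + _); rewrite -signr_odd -[in RHS]signr_odd scaler_sign; case: odd.
Qed.

Lemma charlier0 : charlier 0 = 1.
Proof. by rewrite charlierE big_nat1 big_geq // bin0 mulr1 scale1r. Qed.

Lemma size_charlier (k : nat) : size (charlier k) = k.+1.
Proof.
rewrite charlierE big_nat_recr //= subnn binn mulr1 scale1r addrC.
rewrite size_polyDl size_falling // ltnS big_mkord.
apply: leq_trans (size_sum _ _ _) _; apply/bigmax_leqP => i _.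
by apply: leq_trans (size_scale_leq _ _) _; rewrite size_falling.
Qed.

(** Double counting of pairs ([s], [A]), where [A] is an [i]-set of fixed points of [s]. *)
Lemma sum_bin_fixed_points (n i : nat) : (i <= n)%N ->
  (\sum_(s : 'S_n) 'C(fixed_points s, i) = 'C(n, i) * (n - i)`!)%N.
Proof.
move=> le_in.
pose fixes (A : {set 'I_n}) (s : 'S_n) := A \subset [set x | s x == x].
have fixesE A : #|[set s | fixes A s]| = (n - #|A|)`!.
  (* Fixing [A] pointwise means being supported on its complement, and [card_perm] counts such
     permutations. *)
  have -> : (n - #|A|)%N = #|~: A| by rewrite [RHS]cardsCs setCK card_ord.
  rewrite -card_perm.
  apply: eq_card => s; rewrite inE; apply/subsetP/subsetP => sA x.
    by rewrite !inE; apply: contra => /sA; rewrite inE.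
  by rewrite inE; apply: contraTT => /sA; rewrite inE.
transitivity (\sum_(s : 'S_n) \sum_(A : {set 'I_n} | #|A| == i) fixes A s)%N.
  apply: eq_bigr => s _; rewrite /fixed_points -cards_draws -sum1dep_card.
  by rewrite big_andbC big_mkcondr; apply: eq_bigr => A _; rewrite /fixes; case: ifP.
rewrite exchange_big /= -[n in 'C(n, i)]card_ord -card_draws -sum_nat_const.
apply: eq_big => [A|A /eqP <-]; first by rewrite inE.
by rewrite -fixesE -sum1dep_card [RHS]big_mkcond; apply: eq_bigr => s _; case: ifP.
Qed.

Lemma sum_ffact_fixed_points (n i : nat) : (i <= n)%N ->
  (\sum_(s : 'S_n) fixed_points s ^_ i = n`!)%N.
Proof.
move=> le_in; under eq_bigr do rewrite -bin_ffact.
by rewrite -big_distrl /= sum_bin_fixed_points // mulnAC -mulnA bin_fact.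
Qed.

(** Each falling factorial in [charlierE] sums to [n!] because its order is at most [n]; what
    remains is the binomial expansion of $(1-1)^k$. *)
Lemma sum_charlier_fixed_points (n k : nat) : (0 < k <= n)%N ->
  \sum_(s : 'S_n) (charlier k).[(fixed_points s)%:R] = 0.
Proof.
case/andP=> k_gt0 le_kn; rewrite charlierE.
under eq_bigr do rewrite horner_sum.
rewrite exchange_big /= big_mkord.
transitivity ((1 - 1) ^+ k * n`!%:R : rat); last first.
  by rewrite subrr expr0n eqn0Ngt k_gt0 mul0r.
rewrite [1 - 1]addrC exprDn big_distrl /=; apply: eq_bigr => i _.
under eq_bigr do rewrite hornerZ horner_falling.
rewrite -mulr_sumr -natr_sum sum_ffact_fixed_points; last first.
  by apply: leq_trans le_kn; rewrite -ltnS.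
by rewrite expr1n mulr1 -[in RHS]mulr_natr.
Qed.

Lemma fixed_points_le n (s : 'S_n) : (fixed_points s <= n)%N.
Proof. by rewrite -[n in (_ <= n)%N]card_ord max_card. Qed.

Lemma sum_frequency n (D : {set 'S_n}) (g : nat -> rat) :
  \sum_(0 <= j < n.+1) frequency D j * g j
  = (\sum_(p | p \in setX D D) g (dist_perm p.1 p.2)) / (#|D| ^ 2)%:R.
Proof.
rewrite -(@sum_card_fiber _ _ _ _ _ n.+1) => [|p]; last by rewrite ltnS leq_subr.
rewrite mulr_suml; apply: eq_bigr => j _; rewrite mulrAC.
by congr (_%:R * _ / _); apply: eq_card => p; rewrite !inE andbA.
Qed.

Lemma sum_frequency1 n (D : {set 'S_n}) : D != set0 ->
  \sum_(0 <= j < n.+1) frequency D j = 1.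
Proof.
rewrite -card_gt0 => D_gt0; under eq_bigr do rewrite -[frequency _ _]mulr1.
rewrite (sum_frequency _ (fun=> 1)) sumr_const cardsX -mulnn divff //.
by rewrite pnatr_eq0 -lt0n muln_gt0 D_gt0.
Qed.

Lemma sum_perm_count n (g : nat -> rat) :
  \sum_(0 <= j < n.+1) (perm_count n j)%:R / n`!%:R * g j
  = (\sum_(s : 'S_n) g (n - fixed_points s)%N) / n`!%:R.
Proof.
rewrite -(@sum_card_fiber _ _ _ _ _ n.+1) => [|s]; last by rewrite ltnS leq_subr.
rewrite mulr_suml; apply: eq_big_nat => j /andP[_]; rewrite ltnS => le_jn.
rewrite mulrAC; congr (_%:R * _ / _); apply: eq_card => s; rewrite !inE /=.
have le_sn := fixed_points_le s.
(* Both [j] and the number of fixed points are at most [n], so subtraction from [n] is an involution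
   on them. *)
by apply/eqP/eqP => [->|<-]; rewrite subKn.
Qed.

Lemma sum_perm_count1 n :
  \sum_(0 <= j < n.+1) (perm_count n j)%:R / n`!%:R = 1 :> rat.
Proof.
under eq_bigr do rewrite -[_ / _]mulr1.
rewrite (sum_perm_count _ (fun=> 1)) sumr_const card_Sn divff //.
by rewrite pnatr_eq0 -lt0n fact_gt0.
Qed.

(** [charlier_hat] as an actual polynomial, so that [functional_eq0] can be applied to it. *)
Definition charlier_reflected n k : {poly rat} := charlier k \Po (n%:R%:P - 'X).

Lemma horner_charlier_reflected n k x :
  (charlier_reflected n k).[x] = charlier_hat n k x.
Proof. by rewrite horner_comp; congr _.[_]; rewrite !hornerE. Qed.

Lemma size_charlier_reflected n k : size (charlier_reflected n k) = k.+1.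
Proof.
rewrite size_comp_poly2 ?size_charlier //.
by rewrite addrC size_polyDl size_polyN size_polyX // (leq_ltn_trans (size_polyC_leq1 _)).
Qed.

Lemma sum_perm_count_charlier n k : (0 < k <= n)%N ->
  \sum_(0 <= j < n.+1)
    (perm_count n j)%:R / n`!%:R * (charlier_reflected n k).[j%:R] = 0.
Proof.
move=> hk; rewrite (sum_perm_count _ (fun j => (charlier_reflected n k).[j%:R])).
rewrite (eq_bigr (fun s : 'S_n => (charlier k).[(fixed_points s)%:R])).
  by rewrite sum_charlier_fixed_points ?mul0r.
move=> s _; rewrite horner_charlier_reflected /charlier_hat.
by rewrite natrB ?fixed_points_le // subKr.
Qed.

(** The term at 0 vanishes and the frequencies sum to 1. Hence the criterion of the theorem says
    that the reflected Charlier polynomial has mean zero under the frequencies. *)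
Lemma sum_frequency_charlier n k (D : {set 'S_n}) : D != set0 ->
  \sum_(1 <= i < n.+1)
     frequency D i * (charlier_hat n k 0 - charlier_hat n k i%:R)
  = charlier_hat n k 0
    - \sum_(0 <= j < n.+1) frequency D j * (charlier_reflected n k).[j%:R].
Proof.
move=> D0; transitivity (\sum_(0 <= i < n.+1)
     frequency D i * (charlier_hat n k 0 - charlier_hat n k i%:R)).
  by rewrite [RHS]big_ltn // subrr mulr0 add0r.
under eq_bigr do rewrite mulrBr -!horner_charlier_reflected.
rewrite sumrB -mulr_suml sum_frequency1 // mul1r.
by rewrite horner_charlier_reflected.
Qed.

Theorem theorem5 (n t : nat) (ht : (1 <= t)%N) (hn : (2 * t <= n)%N)
    (D : {set 'S_n}) (hD : D != set0) :
  is_design t D <->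
  (forall k : nat, (1 <= k <= t)%N ->
     \sum_(1 <= i < n.+1)
        frequency D i * (charlier_hat n k 0 - charlier_hat n k i%:R)
     = charlier_hat n k 0).
Proof.
pose w j : rat := (perm_count n j)%:R / n`!%:R.
pose d j := frequency D j - w j.
have sum_d (g : nat -> rat) : \sum_(0 <= j < n.+1) d j * g j
    = \sum_(0 <= j < n.+1) frequency D j * g j
      - \sum_(0 <= j < n.+1) w j * g j.
  by rewrite -sumrB; apply: eq_bigr => j _; rewrite mulrBl.
(* Degree 0, which neither side of the equivalence tests: both distributions have total mass 1. *)
have sum_d1 : \sum_(0 <= j < n.+1) d j * 1 = 0.
  rewrite sum_d; under eq_bigr do rewrite mulr1.
  under [X in _ - X]eq_bigr do rewrite mulr1.
  by rewrite sum_frequency1 // sum_perm_count1 subrr.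
have le_tn : (t <= n)%N by apply: leq_trans hn; rewrite leq_pmull.
have wC k : (1 <= k <= t)%N ->
    \sum_(0 <= j < n.+1) w j * (charlier_reflected n k).[j%:R] = 0.
  case/andP=> k_gt0 le_kt; apply: sum_perm_count_charlier.
  by rewrite k_gt0 (leq_trans le_kt).
split=> [desD k hk | charD i hi].
  (* Subtracting the zero group mean turns the frequency mean into the functional [d], which is then
     tested on monomials. The bound [t.+1] on sizes stands for degree at most [t]. *)
  rewrite sum_frequency_charlier // -[X in _ - X]subr0 -[X in _ - (_ - X)](wC k hk).
  rewrite -sum_d (functional_eq0 (q := fun k => 'X^k) (t := t.+1)) ?subr0 //.
  - by move=> i; rewrite size_polyXn.
  - case=> [_|i le_it]; under eq_bigr do rewrite hornerXn ?expr0; first exact: sum_d1.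
    by rewrite (sum_d (fun j => j%:R ^+ i.+1)) desD // subrr.
  - by rewrite size_charlier_reflected; case/andP: hk.
apply/eqP; rewrite -subr_eq0 -(sum_d (fun j => j%:R ^+ i)); apply/eqP.
under eq_bigr do rewrite -hornerXn.
apply: (functional_eq0 (q := charlier_reflected n) (t := t.+1)).
- exact: size_charlier_reflected.
- case=> [_|k le_kt].
    under eq_bigr do rewrite horner_charlier_reflected /charlier_hat charlier0 hornerC.
    exact: sum_d1.
  (* The group mean is zero by [wC], and [charD] makes the frequency mean zero. *)
  rewrite (sum_d (fun j => (charlier_reflected n k.+1).[j%:R])) wC // subr0.
  have /eqP := charD k.+1 le_kt.
  rewrite sum_frequency_charlier // -[X in _ == X]subr0 (inj_eq (addrI _)).
  by rewrite eqr_opp => /eqP.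
- by rewrite size_polyXn; case/andP: hi.
Qed.
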